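(* Let $g$, $U$ and $G$ be as in the context. Let $p$ be a $[0,1]$-valued random variable that is mirror-conservative, and let $Z$ be a Gaussian random variable, independent of $p$, with mean zero and positive variance. Then the noisy $p$-value $$\tilde p := G\big\{G^{-1}(p)+Z\big\}$$ is also mirror-conservative.
   Context: Mirror-conservative: a $[0,1]$-valued random variable $p$ is mirror-conservative if $\mathbb{P}(p\in[a_1,a_2])\le \mathbb{P}(p\in[1-a_2,1-a_1])$ for all $0\le a_1\le a_2\le 0.5$. Transformation: let $U\in(0,\infty]$ and let $\nu$ be a measure on $\mathbb{R}$ (e.g. Lebesgue measure). Let $g:\mathbb{R}\to[0,\infty)$ be $\nu$-integrable with (1) $g(x)\ge 0$ for $x\in(-U,U)$, $g(x)=0$ for $x\notin(-U,U)$, and $\nu(\{x\in(-U,U): g(x)=0\})=0$; (2) $g(x)=g(-x)$ for all $x$; (3) $\int_{-\infty}^{\infty} g\,d\nu=1$. Set $G(x)=\int_{(-\infty,x]}g\,d\nu$ for $x \in \mathbb{R}$. The probability distribution with density $g$ with respect to $\nu$ is assumed to be symmetric about $0$, and $G$ is assumed to be continuous and strictly increasing on $(-U,U)$, so that $G$ is a bijection from $(-U,U)$ onto $(0,1)$ with inverse (quantile function) $G^{-1}$. By convention $G^{-1}(0)=-U$, $G^{-1}(1)=U$, and $G(-\infty)=0$, $G(\infty)=1$. For finite $U$, $G(x)=0$ for $x\le -U$ and $G(x)=1$ for $x\ge U$. *)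

(* Defs.v *)
From HB Require Import structures.
From mathcomp Require Import all_boot all_order all_algebra.
From mathcomp Require Import all_classical all_reals all_analysis.

Set Implicit Arguments.
Unset Strict Implicit.
Unset Printing Implicit Defensive.

Import Order.TTheory GRing.Theory Num.Theory.
Import numFieldNormedType.Exports.

Local Open Scope classical_set_scope.
Local Open Scope ring_scope.

Definition mirror_conservative d (T : measurableType d) (R : realType)
    (P : probability T R) (X : T -> R) : Prop :=
  [/\ measurable_fun [set: T] X,
      forall t, 0 <= X t <= 1 &
      forall a1 a2 : R, 0 <= a1 -> a1 <= a2 -> a2 <= 2^-1 ->
        (P [set t | a1 <= X t <= a2]%R <=
          P [set t | 1 - a2 <= X t <= 1 - a1]%R)%E].

Definition independent_RV d (T : measurableType d) (R : realType)
    (P : probability T R) (X Y : {RV P >-> R}) : Prop :=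
  forall A B : set R, measurable A -> measurable B ->
    P (X @^-1` A `&` Y @^-1` B) = (P (X @^-1` A) * P (Y @^-1` B))%E.

(* [s] is the standard deviation. *)
Definition gaussian_RV d (T : measurableType d) (R : realType)
    (P : probability T R) (X : {RV P >-> R}) (m s : R) : Prop :=
  forall A : set R, measurable A -> distribution P X A = normal_prob m s A.

Section transformation.
Context {R : realType}.
Implicit Types (nu : {measure set (measurableTypeR R) -> \bar R}).
Implicit Types (U : \bar R) (g : R -> R).

(* The open interval (-U, U) of the real line, where U may be +oo. *)
Definition sym_itv U : set R := [set x | (- U < x%:E < U)%E].

Definition cumul nu g (x : R) : R := \int[nu]_(y in `]-oo, x]) g y.

Definition cumul_ext nu g (x : \bar R) : R :=
  match x with
  | r%:E => cumul nu g r
  | +oo%E => 1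
  | -oo%E => 0
  end.

(* Only meaningful on [0, 1]; on (0, 1) it is the inverse of the bijection
   [cumul nu g] from (-U, U) onto (0, 1). *)
Definition cumul_inv nu U g (q : R) : \bar R :=
  if q == 0 then (- U)%E
  else if q == 1 then U
  else ('pinv_(fun=> 0) (sym_itv U) (cumul nu g) q)%:E.

Record transformation_density nu U g : Prop := {
  td_U_gt0 : (0 < U)%E ;
  td_ge0 : forall x, 0 <= g x ;
  td_integrable : nu.-integrable [set: R] (EFin \o g) ;
  td_out : forall x, ~ sym_itv U x -> g x = 0 ;
  td_null : nu [set x | sym_itv U x /\ g x = 0] = 0%E ;
  td_even : forall x, g x = g (- x) ;
  td_mass : (\int[nu]_x (g x)%:E = 1)%E ;
  td_sym : forall A : set R, measurable A ->
    (\int[nu]_(x in A) (g x)%:E = \int[nu]_(x in -%R @` A) (g x)%:E)%E ;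
  td_continuous : forall x, sym_itv U x -> {for x, continuous (cumul nu g)} ;
  td_increasing : forall x y, sym_itv U x -> sym_itv U y ->
    x < y -> cumul nu g x < cumul nu g y
}.

Definition noisy_pvalue nu U g (T : Type) (p Z : T -> R) : T -> R :=
  fun t => cumul_ext nu g (cumul_inv nu U g (p t) + (Z t)%:E)%E.

End transformation.

(* Main.v *)
(* Put X = G^-1(p).  Since G(-x) = 1 - G(x), mirroring the p-value amounts to
   changing the sign of X.  For q in [0, 1] let f(q) be the Gaussian probability
   that G(G^-1(q) + Z) lies in [a1, a2]; the symmetry of Z makes f(1 - q) the
   probability that it lies in [1 - a2, 1 - a1].  For q >= 1/2 and a2 <= 1/2 we
   have f(q) <= f(1 - q): as x = G^-1(q) >= 0 and G^-1([a1, a2]) lies in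
   ]-oo, 0], the Gaussian density at y + x dominates the density at y - x for
   every y in that set.  By independence it remains to see that
   E f(p) <= E f(1 - p).  Mirror-conservativeness says that on ]1/2, 1] the law
   of 1 - p is below the law of p on every interval; hence there the law of p is
   the sum of the law of 1 - p and of a Stieltjes measure, and the two
   expectations differ by the integral of f(1 - q) - f(q) >= 0 against the
   latter. *)

Require Import Defs.
From HB Require Import structures.
From mathcomp Require Import all_boot all_order all_algebra.
From mathcomp Require Import all_classical all_reals all_analysis.
From mathcomp Require Import measurable_realfun lra.

Set Implicit Arguments.
Unset Strict Implicit.
Unset Printing Implicit Defensive.

Import Order.TTheory GRing.Theory Num.Theory.
Import numFieldNormedType.Exports.
Local Open Scope classical_set_scope.
Local Open Scope ring_scope.

(** * Finite measures compared on half-open intervals *)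

Section finite_measures_on_the_line.
Context {R : realType}.
Implicit Types mu : {finite_measure set (measurableTypeR R) -> \bar R}.

Lemma finite_measure_cvg_ray mu (a : R) :
  fine (mu `]-oo, a + n.+1%:R^-1]%classic) @[n --> \oo] -->
  fine (mu `]-oo, a]%classic).
Proof.
apply/fine_cvg; rewrite fineK ?fin_num_measure// (itvNycEbigcap false).
apply: (@nonincreasing_cvg_mu _ _ _ mu (fun n => `]-oo, a + n.+1%:R^-1]%classic)).
- by rewrite -ge0_fin_numE// fin_num_measure.
- by move=> i; exact: measurable_itv.
- by apply: bigcap_measurable => // k _; exact: measurable_itv.
- move=> m n mn; apply/subsetPset; apply: subset_itvl.
  by rewrite bnd_simp lerD2l lef_pV2 ?posrE// ler_nat.
Qed.

(** For [x] close to [a] on the right, monotonicity squeezes [f x] between [f a] and one term of the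
    sequence, so a single sequence decides the right limit. *)
Lemma nondecreasing_cvg_right_continuous (f : R -> R) : nondecreasing f ->
  (forall a, f (a + n.+1%:R^-1) @[n --> \oo] --> f a) -> right_continuous f.
Proof.
move=> ndf fcvg a; apply/cvgrPdist_le => e e0.
have /cvgrPdist_le/(_ e e0)[N _ /(_ N (leqnn N))/= fN] := fcvg a.
near=> x.
have ax : a <= x by near: x; exact: nbhs_right_ge.
have xN : x <= a + N.+1%:R^-1.
  by near: x; apply: nbhs_right_le; rewrite ltrDl.
apply: le_trans fN.
rewrite distrC ger0_norm ?subr_ge0 ?ndf// distrC ger0_norm ?subr_ge0 ?ndf//.
  by rewrite lerD2r ndf.
by rewrite lerDl.
Unshelve. all: by end_near. Qed.

Lemma measure_ocitv mu (a b : R) : a <= b ->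
  mu `]a, b]%classic = (fine (mu `]-oo, b]%classic) - fine (mu `]-oo, a]%classic))%:E.
Proof.
move=> ab; have -> : `]a, b]%classic = `]-oo, b]%classic `\` `]-oo, a]%classic :> set R.
  by rewrite -[RHS]setCK setCD setCitvl setUC -[LHS]setCK setCitv.
rewrite measureD//; last by rewrite -ge0_fin_numE// fin_num_measure.
rewrite setIidr; last exact: subset_itvl.
by rewrite EFinB !fineK// fin_num_measure.
Qed.

Lemma lebesgue_stieltjes_measure_ocitv (f : cumulative R R) (a b : R) : a <= b ->
  lebesgue_stieltjes_measure f `]a, b]%classic = (f b - f a)%:E.
Proof.
move=> ab; rewrite /lebesgue_stieltjes_measure /measure_extension/=.
rewrite measurable_mu_extE/=; last exact: is_ocitv.
by rewrite wlength_itv_bnd.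
Qed.

(** The difference [F] of the two distribution functions is nondecreasing by the hypothesis, and
    right-continuous because both rays pass to the limit. Its Stieltjes measure is the required
    [lam]: [mu1] and [mu2 + lam] agree on the half-open intervals, which form a pi-system generating
    the Borel sets. *)
Lemma le_ocitv_measure_add mu1 mu2 :
  (forall a b : R, a <= b -> (mu2 `]a, b]%classic <= mu1 `]a, b]%classic)%E) ->
  exists lam : {measure set (measurableTypeR R) -> \bar R},
    forall A, measurable A -> mu1 A = measure_add mu2 lam A.
Proof.
move=> le21.
pose F x := fine (mu1 `]-oo, x]%classic) - fine (mu2 `]-oo, x]%classic).
have ndF : nondecreasing F.
  move=> a b ab; rewrite /F; have := le21 _ _ ab.
  rewrite !measure_ocitv// lee_fin; lra.
have rcF : right_continuous F.
  apply: nondecreasing_cvg_right_continuous => // a.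
  by apply: cvgB; exact: finite_measure_cvg_ray.
pose FM := isCumulative.Build R _ R F ndF rcF.
pose F' : cumulative R R := HB.pack F FM.
exists (lebesgue_stieltjes_measure F') => A mA.
apply: (@measure_unique _ R (measurableTypeR R) (@ocitv R)
  (fun k => `]- k%:R, k%:R]%classic) _ _ _ _ mu1
  (measure_add mu2 (lebesgue_stieltjes_measure F'))) => //.
- exact: (@ocitvI R).
- by move=> i; exact: is_ocitv.
- exact: bigcup_itvT.
- move=> _ [[a b] _ <-] /=.
  transitivity (mu2 `]a, b]%classic +
      lebesgue_stieltjes_measure F' `]a, b]%classic)%E; last first.
    exact/esym/measure_addE.
  (* The generators also include the pairs with [b < a], whose interval is empty. *)
  have [ab|ba] := leP a b; last first.
    have -> : `]a, b]%classic = set0 :> set R.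
      by rewrite set_itv_ge// bnd_simp -leNgt ltW.
    by rewrite !measure0 adde0.
  rewrite lebesgue_stieltjes_measure_ocitv//.
  by rewrite /= !measure_ocitv// -EFinD; congr EFin; rewrite /F; lra.
- by move=> k; rewrite -ge0_fin_numE// fin_num_measure.
Qed.
End finite_measures_on_the_line.

(** * Translation and reflection of centered normal laws *)

Section normal_translation.
Context {R : realType}.
Local Notation mu := (@lebesgue_measure R).

Lemma lebesgue_measure_shift (c : R) (A : set R) : measurable A ->
  pushforward mu (+%R c : _ -> measurableTypeR R) A = mu A.
Proof.
move=> mA.
have mc : measurable_fun setT (+%R c : measurableTypeR R -> measurableTypeR R).
  exact: measurable_funD.
pose phi : {mfun _ >-> _} := HB.pack (+%R c : measurableTypeR R -> measurableTypeR R)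
  (isMeasurableFun.Build _ _ _ _ _ mc).
apply/esym/(@lebesgue_measure_unique _ (pushforward mu phi)) => //= _ [[a b]] _ <-.
rewrite /pushforward/=.
have -> : +%R c @^-1` `]a, b] = `]a - c, b - c]%classic.
  by apply/seteqP; split => x/=; rewrite !in_itv/= ltrBlDl lerBrDl.
rewrite !lebesgue_measure_itv/= !lte_fin ltrD2r.
by case: ifP => // _; rewrite -!EFinD; congr EFin; lra.
Qed.

Lemma normal_prob_shift (s c : R) (A : set R) : measurable A ->
  normal_prob 0 s A =
  (\int[mu]_(x in +%R c @^-1` A) (normal_pdf 0 s (c + x))%:E)%E.
Proof.
move=> mA; rewrite /normal_prob.
have mc : measurable_fun setT (+%R c : measurableTypeR R -> measurableTypeR R).
  exact: measurable_funD.
rewrite -(@ge0_integral_pushforward _ _ _ _ _ _ mc mu A (EFin \o normal_pdf 0 s))//=.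
- apply: eq_measure_integral => B mB BA; exact/esym/lebesgue_measure_shift.
- by apply/measurable_EFinP; apply: measurable_funTS; exact: measurable_normal_pdf.
- by move=> y _; rewrite lee_fin normal_pdf_ge0.
Qed.

Lemma normal_probN (s : R) (A : set R) : s != 0 -> measurable A ->
  normal_prob 0 s (-%R @^-1` A) = normal_prob 0 s A.
Proof.
move=> s0 mA; rewrite /normal_prob.
have mN : measurable_fun setT (-%R : measurableTypeR R -> measurableTypeR R).
  exact: measurable_funN.
transitivity (\int[mu]_(x in -%R @^-1` A) (normal_pdf 0 s (- x))%:E)%E.
  apply: eq_integral => x _; congr EFin.
  by rewrite normal_pdfE// /normal_fun !subr0 sqrrN.
rewrite -(@ge0_integral_pushforward _ _ _ _ _ _ mN mu A (EFin \o normal_pdf 0 s))//=.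
- apply: eq_measure_integral => B mB BA; exact: lebesgue_measureN.
- by apply/measurable_EFinP; apply: measurable_funTS; exact: measurable_normal_pdf.
- by move=> y _; rewrite lee_fin normal_pdf_ge0.
Qed.

(** Shifting the right-hand side by [x + x] turns both sides into integrals over the [z] with
    [x + z] in [A], of the density at [z] on the left and at [x + x + z] on the right. On that set
    [x + z <= 0], so [x + x + z] is no farther from 0 than [z]. *)
Lemma normal_prob_le_shift (s x : R) (A : set R) : s != 0 -> measurable A ->
  0 <= x -> (forall y, A y -> y <= 0) ->
  (normal_prob 0 s (+%R x @^-1` A) <= normal_prob 0 s (+%R (- x) @^-1` A))%E.
Proof.
move=> s0 mA x0 A0.
have mc (c : R) : measurable (+%R c @^-1` A).
  rewrite -[X in measurable X]setTI.
  by apply: (measurable_funD (measurable_cst c) (@measurable_id _ _ setT)).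
rewrite (@normal_prob_shift s (x + x) _ (mc (- x))).
rewrite [X in (_ <= integral _ X _)%E](_ : _ = +%R x @^-1` A); last first.
  have E (y : R) : - x + (x + x + y) = x + y by rewrite -(addrA x x) addKr.
  by apply/funext => y; exact: (congr1 A (E y)).
apply: ge0_le_integral => //.
- exact: mc.
- by move=> z _; rewrite lee_fin normal_pdf_ge0.
- by apply/measurable_EFinP; apply: measurable_funTS; exact: measurable_normal_pdf.
- apply/measurable_EFinP; apply: measurable_funTS.
  apply: measurableT_comp; first exact: measurable_normal_pdf.
  exact: measurable_funD.
- move=> z /A0 xz; rewrite lee_fin !normal_pdfE// ler_wpM2l ?normal_peak_ge0//.
  rewrite /normal_fun !subr0 ler_expR !mulNr lerN2 ler_wpM2r//.
    by rewrite invr_ge0 mulrn_wge0// sqr_ge0.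
  (* This product is a quarter of [z ^+ 2 - (x + x + z) ^+ 2]. *)
  have : 0 <= x * - (x + z) by rewrite mulr_ge0// oppr_ge0.
  by rewrite !expr2; nra.
Qed.

End normal_translation.

(** Supplies points of (-U, U) along which G is later shown to come arbitrarily close to 1:
    [u * (1 - 1 / (n + 1))] for a finite bound [u], and [n] for an infinite one. *)
Lemma sym_itv_exhaustion (R : realType) (U : \bar R) : (0 < U)%E ->
  exists Y : nat -> R, [/\ nondecreasing_seq Y,
  forall n, 0 <= Y n, forall n, sym_itv U (Y n) & forall y, sym_itv U y ->
      exists n, y <= Y n].
Proof.
rewrite /sym_itv; case: U => [u| |]//= u0.
  rewrite lte_fin in u0.
  have Ygt0 n : 0 <= u * (1 - n.+1%:R^-1).
    by rewrite mulr_ge0 ?(ltW u0)// subr_ge0 invf_le1// ler1n.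
  exists (fun n => u * (1 - n.+1%:R^-1)); split=> //.
  - move=> m n mn; rewrite ler_pM2l// lerD2l lerN2 lef_pV2 ?posrE//.
    by rewrite ler_nat.
  - move=> n; rewrite !lte_fin; apply/andP; split.
      by rewrite (lt_le_trans _ (Ygt0 n))// oppr_lt0.
    by rewrite -subr_gt0 mulrBr mulr1 opprB addrC subrK mulr_gt0// invr_gt0.
  - move=> y /andP[_]; rewrite lte_fin => yu.
    have e0 : 0 < (u - y) / u by rewrite divr_gt0// subr_gt0.
    have [n _ /(_ n (leqnn n))/= nlt] := near_infty_natSinv_lt (PosNum e0).
    exists n; have : u * n.+1%:R^-1 <= u - y.
      by rewrite mulrC -ler_pdivlMr//; exact: ltW.
    by rewrite mulrBr mulr1 lerBrDl lerBrDr.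
exists (fun n => n%:R); split=> //.
- by move=> m n mn; rewrite ler_nat.
- by move=> n; rewrite ltNyr ltry.
- move=> y _; exists (Num.truncn `|y|).+1.
  by rewrite (le_trans (ler_norm y))// ltW// truncnS_gt.
Qed.

Lemma nondecreasing_itv_measurable (R : realType) (i : interval R) (f : R -> R) :
  {in i &, {homo f : x y / x <= y}} -> measurable_fun [set` i] f.
Proof.
move=> ndf.
apply: (measurability (@RGenCInfty.G R)) => [|/= _ [_] [r] -> <-].
  exact: RGenCInfty.measurableE.
apply: is_interval_measurable => s t [/= si fs] [/= ti ft] u /andP[su ut].
have ui : u \in i by apply: (@interval_is_interval _ i s t) => //; rewrite su.
split=> //=; move: fs; rewrite !in_itv/= !andbT => /le_trans; apply; exact: ndf.
Qed.

(** * The distribution function G and its quantile function *)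

Section transformation_theory.
Context {R : realType} (nu : {measure set (measurableTypeR R) -> \bar R}).
Context (U : \bar R) (g : R -> R) (hg : transformation_density nu U g).

Local Notation G := (cumul nu g).
Local Notation I := (sym_itv U).
Local Notation mass A := (\int[nu]_(y in A) (g y)%:E)%E.

Let mg (A : set (measurableTypeR R)) : measurable_fun A (EFin \o g).
Proof. by apply: measurable_funTS; exact: measurable_int (td_integrable hg). Qed.

Let mass_ge0 (A : set R) : (0 <= mass A)%E.
Proof. by apply: integral_ge0 => x _; rewrite lee_fin (td_ge0 hg). Qed.

Let le_mass (A B : set (measurableTypeR R)) : measurable A -> measurable B ->
  A `<=` B -> (mass A <= mass B)%E.
Proof.
move=> mA mB AB; apply: ge0_subset_integral => //.
by move=> x _; rewrite lee_fin (td_ge0 hg).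
Qed.

Let mass_le1 (A : set (measurableTypeR R)) : measurable A -> (mass A <= 1)%E.
Proof. by move=> mA; rewrite -(td_mass hg); apply: le_mass. Qed.

Let mass_fin (A : set (measurableTypeR R)) : measurable A -> mass A \is a fin_num.
Proof.
by move=> mA; rewrite ge0_fin_numE// (le_lt_trans (mass_le1 mA))// ltry.
Qed.

Let massU (A B : set (measurableTypeR R)) : measurable A -> measurable B ->
  [disjoint A & B] -> mass (A `|` B) = (mass A + mass B)%E.
Proof.
move=> mA mB AB; apply: ge0_integral_setU => //.
by move=> x _; rewrite lee_fin (td_ge0 hg).
Qed.

Let mass_disjoint (A : set R) : (forall x, A x -> ~ I x) -> mass A = 0%E.
Proof. by move=> AI; apply: integral0_eq => x /AI /(td_out hg) ->. Qed.

Let mass_cover (A : set (measurableTypeR R)) : measurable A ->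
  (forall x, I x -> A x) -> mass A = 1%E.
Proof.
move=> mA IA; rewrite -(td_mass hg) -(setvU A) massU//; last 2 first.
  exact: measurableC.
  by apply/disj_setPS => x [].
by rewrite (@mass_disjoint (~` A)) ?add0e// => x nA /IA.
Qed.

Let cumulE x : (G x)%:E = mass `]-oo, x].
Proof. by rewrite /cumul /Rintegral fineK//; apply: mass_fin. Qed.

Lemma cumul_ge0 x : 0 <= G x.
Proof. by rewrite -lee_fin cumulE. Qed.

Lemma cumul_le1 x : G x <= 1.
Proof. by rewrite -lee_fin cumulE mass_le1. Qed.

Lemma cumul_nondecreasing : {homo G : x y / x <= y}.
Proof.
move=> x y xy; rewrite -lee_fin !cumulE; apply: le_mass => //.
exact: subset_itvl.
Qed.

Lemma sym_itvN x : I x -> I (- x).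
Proof.
rewrite /sym_itv/= EFinN => /andP[Ux xU]; apply/andP; split.
  by rewrite lteN2.
by rewrite lteNl.
Qed.

Lemma sym_itv0 : I 0.
Proof. by rewrite /sym_itv/= oppe_lt0 (td_U_gt0 hg). Qed.

(** The measure [nu] may have atoms, so this comes from the continuity of G: inside (-U, U) the mass
    of the point is at most the increment of G over a short interval ending at [x]. Outside, the
    density vanishes. *)
Let mass_set1 x : mass [set x] = 0%E.
Proof.
have [Ix|nIx] := pselect (I x); last by apply: mass_disjoint => _ ->.
apply/eqP; rewrite eq_le mass_ge0 andbT.
apply/lee_addgt0Pr => e e0; rewrite add0e.
have /cvgrPdist_lt/(_ e e0)/nbhs_ballP[d/= d0 Hd] := td_continuous hg Ix.
have dx : x - d / 2 < x by rewrite ltrBlDr ltrDl divr_gt0.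
have /Hd : ball x d (x - d / 2).
  by rewrite /ball/= opprB addrC subrK gtr0_norm ?divr_gt0//; lra.
rewrite /= ger0_norm ?subr_ge0 ?cumul_nondecreasing ?(ltW dx)// ltrBlDr => Gxe.
rewrite -(@leeD2rE _ (G (x - d / 2))%:E)// [in leLHS]cumulE -massU//; last first.
  by apply/disj_setPS => _ [->]/=; rewrite in_itv/= leNgt dx.
rewrite -EFinD (@le_trans _ _ (G x)%:E)//; last by rewrite lee_fin ltW.
rewrite cumulE; apply: le_mass => //; first exact: measurableU.
by move=> y [->|]/=; rewrite !in_itv/=// => /le_trans; apply; exact: ltW.
Qed.

(** Symmetry moves the mass of []-oo, x]] to [[-x, +oo[]. Once the massless point [-x] is removed,
    this ray and []-oo, -x]] partition the line. *)
Lemma cumulN x : G (- x) = 1 - G x.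
Proof.
suff: (G x + G (- x))%:E = 1%:E by move=> [<-]; lra.
rewrite EFinD [in LHS]cumulE (td_sym hg)// opp_itvNy_bnd/=.
rewrite -(@setU1itv _ _ _ _ false)// massU//; last first.
  by apply/disj_setPS => _ [->]/=; rewrite in_itv/= ltxx.
rewrite mass_set1 add0e cumulE -massU//; last first.
  by apply/disj_setPS => y []/=; rewrite !in_itv/= andbT ltNge => /negP.
rewrite mass_cover//; first exact: measurableU.
by move=> y _; case: (leP y (- x)) => ?; [right|left];
  rewrite /= in_itv/= ?andbT.
Qed.

Lemma cumul0 : G 0 = 2^-1.
Proof. by have := cumulN 0; rewrite oppr0; lra. Qed.

Lemma cumul_gt_half x : 0 < x -> 2^-1 < G x.
Proof.
move=> x0; rewrite -cumul0.
have [Ix|nIx] := pselect (I x); first exact: (td_increasing hg sym_itv0 Ix).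
(* Here [x] lies at or beyond U, so []-oo, x]] contains all of (-U, U). *)
suff -> : G x = 1 by rewrite cumul0; lra.
apply: EFin_inj; rewrite cumulE; apply: mass_cover => // y; rewrite /= in_itv/=.
rewrite /sym_itv/= => /andP[_ yU]; rewrite leNgt; apply/negP => xy; apply: nIx.
rewrite /sym_itv/=; apply/andP; split.
  by rewrite (@lt_trans _ _ 0%E) ?lte_fin// oppe_lt0 (td_U_gt0 hg).
by rewrite (lt_trans _ yU)// lte_fin.
Qed.

(** Intermediate values between G 0 = 1/2 and some [G (Y n) > q]. Such an [n] exists: otherwise
    continuity from below would bound by [q < 1] the mass of a union of rays that covers (-U, U).
    Values below 1/2 then follow by reflection. *)
Let cumul_surj_half q : 2^-1 <= q < 1 -> exists2 x, I x & G x = q.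
Proof.
move=> /andP[q2 q1].
have [Y [ndY Y0 IY Ycof]] := sym_itv_exhaustion (td_U_gt0 hg).
have [n qn] : exists n, q < G (Y n).
  apply: contrapT => /forallNP nq.
  have : (mass (\bigcup_n `]-oo, Y n]%classic) <= q%:E)%E.
    have cvgm : mass `]-oo, Y n]%classic @[n --> \oo] -->
        mass (\bigcup_n `]-oo, Y n]%classic).
      apply: (@ge0_nondecreasing_set_cvg_integral _ (measurableTypeR R) R
        (fun n => `]-oo, Y n]%classic) (EFin \o g) nu) => //.
      - by move=> m n mn; apply/subsetPset/subset_itvl; rewrite bnd_simp ndY.
      - by move=> i x _; rewrite lee_fin (td_ge0 hg).
    rewrite -(cvg_lim _ cvgm)//; apply: lime_le.
      by apply/cvg_ex; eexists; exact: cvgm.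
    by apply: nearW => n /=; rewrite -cumulE lee_fin leNgt; exact/negP/nq.
  rewrite mass_cover//.
  - by rewrite lee_fin leNgt q1.
  - by apply: bigcup_measurable => k _; exact: measurable_itv.
  - by move=> y /Ycof[k yk]; exists k => //=; rewrite in_itv.
have itvI x : 0 <= x -> x <= Y n -> I x.
  have := IY n; rewrite /sym_itv/= => /andP[_ YU] x0 xY; apply/andP; split.
    by rewrite (@lt_le_trans _ _ 0%E) ?lee_fin// oppe_lt0 (td_U_gt0 hg).
  by rewrite (le_lt_trans _ YU)// lee_fin.
have cG : {within `[0, Y n], continuous G}.
  apply: continuous_in_subspaceT => x; rewrite inE/= in_itv/= => /andP[x0 xY].
  exact: (td_continuous hg (itvI _ x0 xY)).
have [||c] := @IVT _ G 0 (Y n) q _ cG => //.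
  rewrite cumul0 min_l ?max_r; last 2 first.
    by rewrite (le_trans q2)// ltW.
    by rewrite (le_trans q2)// ltW.
  by rewrite q2 ltW.
by rewrite in_itv/= => /andP[c0 cY] Gc; exists c => //; exact: itvI.
Qed.

Lemma cumul_surj q : 0 < q < 1 -> exists2 x, I x & G x = q.
Proof.
move=> /andP[q0 q1]; have [q2|q2] := leP 2^-1 q.
  by apply: cumul_surj_half; rewrite q2.
have [|x Ix Gx] := @cumul_surj_half (1 - q); first by apply/andP; split; lra.
by exists (- x); [exact: sym_itvN|rewrite cumulN Gx; lra].
Qed.

Lemma cumul_inj x y : I x -> I y -> G x = G y -> x = y.
Proof.
move=> Ix Iy Gxy; apply/eqP; rewrite eq_le !leNgt.
by apply/andP; split; apply/negP => /(td_increasing hg) H;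
  [have := H Iy Ix|have := H Ix Iy]; rewrite Gxy ltxx.
Qed.

Local Notation X := (cumul_inv nu U g).

Lemma cumul_inv0 : X 0 = (- U)%E. Proof. by rewrite /cumul_inv eqxx. Qed.

Lemma cumul_inv1 : X 1 = U. Proof. by rewrite /cumul_inv oner_eq0 eqxx. Qed.

(** Surjectivity writes [q] as a value of G on (-U, U), so injectivity determines [pinv] there and
    its default value 0 never enters. *)
Lemma cumul_invP q : 0 < q < 1 -> exists x, [/\ X q = x%:E, I x & G x = q].
Proof.
move=> q01; have [x Ix Gx] := cumul_surj q01.
have /andP[q0 q1] := q01.
rewrite /cumul_inv gt_eqF// lt_eqF//; exists x; split=> //; congr EFin.
rewrite -Gx; apply: (@pinvKV _ _ (fun=> 0)); last by rewrite inE.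
by move=> y z; rewrite !inE; exact: cumul_inj.
Qed.

(** Inside ]0, 1[ this is [cumulN] read through the injectivity of G; at 0 and 1 it is the
    convention on the values -U and U. *)
Lemma cumul_inv_onem q : 0 <= q <= 1 -> X (1 - q) = (- X q)%E.
Proof.
move=> /andP[]; rewrite le_eqVlt => /predU1P[<- _|q0].
  by rewrite subr0 cumul_inv1 cumul_inv0 oppeK.
rewrite le_eqVlt => /predU1P[->|q1]; first by rewrite subrr cumul_inv1 cumul_inv0.
have [|x [-> Ix Gx]] := @cumul_invP q; first by rewrite q0.
have [|y [-> Iy Gy]] := @cumul_invP (1 - q); first by apply/andP; split; lra.
rewrite -EFinN; congr EFin; apply: cumul_inj => //; first exact: sym_itvN.
by rewrite cumulN Gy Gx.
Qed.

Lemma cumul_inv_ge0 q : 2^-1 <= q <= 1 -> (0 <= X q)%E.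
Proof.
move=> /andP[q2]; rewrite le_eqVlt => /predU1P[->|q1].
  by rewrite cumul_inv1 ltW// (td_U_gt0 hg).
have [|x [-> Ix Gx]] := @cumul_invP q; first by apply/andP; split; lra.
rewrite lee_fin leNgt; apply/negP => x0.
have : 2^-1 < G (- x) by rewrite cumul_gt_half// oppr_gt0.
by rewrite cumulN Gx; lra.
Qed.

Lemma cumul_ext_bounds x : 0 <= cumul_ext nu g x <= 1.
Proof. by case: x => [r| |]/=; rewrite ?cumul_ge0 ?cumul_le1 ?ler01 ?lexx. Qed.

Lemma cumul_extN x : cumul_ext nu g (- x)%E = 1 - cumul_ext nu g x.
Proof. by case: x => [r| |]/=; rewrite ?cumulN ?subrr ?subr0. Qed.

Lemma measurable_cumul_ext : measurable_fun [set: \bar R] (cumul_ext nu g).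
Proof.
rewrite (_ : cumul_ext nu g = fun y => if y == +oo%E then 1 else
    if y == -oo%E then 0 else G (fine y)); last by apply/funext => -[].
have meq (y : \bar R) : measurable_fun [set: \bar R] (fun z => z == y).
  apply: (measurable_fun_bool true) => //; rewrite setTI.
  rewrite (_ : _ @^-1` _ = [set y]); first exact: emeasurable_set1.
  by apply/seteqP; split => z /=; [move/eqP|move=> ->; rewrite eqxx].
apply: measurable_fun_ifT => //; apply: measurable_fun_ifT => //.
apply: measurableT_comp => //.
apply: nondecreasing_measurable => //; exact: cumul_nondecreasing.
Qed.

(** The values at 0 and 1 may be infinite, and [fine] would send them to 0 and spoil monotonicity.
    Hence the reduction to ]0, 1[, where the quantile function is finite and monotone. *)
Lemma measurable_cumul_inv : measurable_fun (`[0, 1]%classic : set R) X.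
Proof.
apply: (@emeasurable_fun_itv_cc _ _ _ false true).
apply: (@eq_measurable_fun _ _ _ _ _ (EFin \o (fine \o X))).
  by move=> q; rewrite inE/= in_itv/= => /cumul_invP[x [-> _ _]].
apply/measurable_EFinP; apply: nondecreasing_itv_measurable => s t.
rewrite !in_itv/= => /cumul_invP[x [-> Ix <-]] /cumul_invP[y [-> Iy <-]] /=.
rewrite !leNgt; apply: contra; exact: (td_increasing hg).
Qed.

End transformation_theory.

(** * Integrals against the law of a mirror-conservative p-value *)

Section mirror_integral.
Context {R : realType} d (T : measurableType d) (P : probability T R).
Context (p : {RV P >-> R}) (hp : mirror_conservative P p).

Let p01 t : 0 <= p t <= 1. Proof. by have [_ + _] := hp; apply. Qed.

Let mp : measurable_fun [set: T] (p : T -> measurableTypeR R).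
Proof. exact: (measurable_funPT p). Qed.

Let mpN : measurable_fun [set: T] ((fun t => 1 - p t) : T -> measurableTypeR R).
Proof.
have h : measurable_fun [set: T] (fun t => 1 - p t) by exact: measurable_funB.
exact: h.
Qed.

(** [X] and [XN] are [p] and [1 - p] retyped so that their laws live on [measurableTypeR R], like
    the measures compared in [le_ocitv_measure_add]. *)
Let X : {mfun T >-> measurableTypeR R} :=
  HB.pack (p : T -> measurableTypeR R) (isMeasurableFun.Build _ _ _ _ _ mp).

Let XN : {mfun T >-> measurableTypeR R} :=
  HB.pack ((fun t => 1 - p t) : T -> measurableTypeR R)
    (isMeasurableFun.Build _ _ _ _ _ mpN).

Let E : set (measurableTypeR R) := `[2^-1, 1]%classic.
Let D : set (measurableTypeR R) := `]2^-1, 1]%classic.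
Let mE : measurable E. Proof. exact: measurable_itv. Qed.
Let mD : measurable D. Proof. exact: measurable_itv. Qed.

Let law := distribution P X.
Let lawN := distribution P XN.

(* Assigning the point 1/2 to [m1] only makes [m1] and [m2] cover the whole law
   of [p] without overlap. *)
Let m1 : {finite_measure set (measurableTypeR R) -> \bar R} := mrestr law mE.
Let m2 : {finite_measure set (measurableTypeR R) -> \bar R} := mrestr lawN mD.

(** The hypothesis on [p] concerns closed intervals, so the half-open one is approached from inside
    by [[c n, b']], and [F n] is the event that [1 - p] lies there. As [c n] may equal 1/2, [F n]
    may contain outcomes with [p t = 1/2], which [m2] ignores and [m1] counts; hence only an
    inequality in [m2F]. *)
Let le_m2_m1 (a b : R) : a <= b -> (m2 `]a, b]%classic <= m1 `]a, b]%classic)%E.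
Proof.
move=> ab; pose c n := Num.max 2^-1 (a + n.+1%:R^-1); pose b' := Num.min b 1.
pose F n := [set t | 1 - b' <= p t <= 1 - c n].
have mpitv (x y : R) : measurable [set t | x <= p t <= y].
  rewrite (_ : [set t | _] = p @^-1` `[x, y]); last first.
    by apply/seteqP; split => t /=; rewrite in_itv.
  by rewrite -[X in measurable X]setTI; exact: measurable_funP.
have mF n : measurable (F n) by exact: mpitv.
have m1E : m1 `]a, b]%classic = P [set t | a < p t <= b /\ 2^-1 <= p t <= 1].
  congr (P _); by apply/seteqP; split => t; rewrite /E/= !in_itv.
have m2F : (m2 `]a, b]%classic <= P (\bigcup_n F n))%E.
  rewrite [leLHS](_ : _ = P ((fun t => 1 - p t) @^-1` (`]a, b]%classic `&` D)))//.
  apply: le_measure; rewrite ?inE.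
  - rewrite -[X in measurable X]setTI; apply: mpN => //.
    by apply: measurableI.
  - by apply: bigcup_measurable => k _; exact: mF.
  move=> t; rewrite /D/= !in_itv/= => -[/andP[at1 tb] /andP[t2 t1]].
  have e0 : 0 < 1 - p t - a by rewrite subr_gt0.
  have [n _ /(_ n (leqnn n))/= nlt] := near_infty_natSinv_lt (PosNum e0).
  exists n => //; rewrite /F/=; apply/andP; split.
    by rewrite lerBlDr -lerBlDl le_min tb t1.
  by rewrite lerBrDr -lerBrDl ge_max ltW//= addrC -lerBrDr ltW.
apply: (le_trans m2F); rewrite m1E.
have cvgF : P (F n) @[n --> \oo] --> P (\bigcup_n F n).
  apply: nondecreasing_cvg_mu => //; first by apply: bigcup_measurable => k _; exact: mF.
  move=> m n mn; apply/subsetPset => t; rewrite /F/= => /andP[-> tm]/=.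
  rewrite (le_trans tm)// lerD2l lerN2 ge_max !le_max lexx/= lerD2l.
  by rewrite lef_pV2 ?posrE// ler_nat ltnS mn orbT.
rewrite -(cvg_lim _ cvgF)//; apply: lime_le.
  by apply/cvg_ex; eexists; exact: cvgF.
apply: nearW => n.
have [cb|bc] := leP (c n) b'; last first.
  rewrite (_ : F n = set0) ?measure0//.
  by apply/seteqP; split => t //; rewrite /F/= => /andP[]; lra.
have [_ _ hP] := hp.
have := hP (1 - b') (1 - c n).
rewrite !subKr => /(_ _ _ _)/le_trans; apply.
- by rewrite subr_ge0 ge_min lexx orbT.
- by rewrite lerD2l lerN2.
- have : 2^-1 <= c n by rewrite le_max lexx.
  lra.
- apply: le_measure; rewrite ?inE//.
    rewrite (_ : [set t | _] = p @^-1` (`]a, b] `&` E)).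
      rewrite -[X in measurable X]setTI.
      by apply: measurable_funP => //; exact: measurableI.
    by apply/seteqP; split => t; rewrite /E/= !in_itv.
  move=> t /=; rewrite le_min ge_max => /andP[/andP[t2 ta] /andP[-> ->]].
  by rewrite t2/= !andbT (lt_le_trans _ ta)// ltrDl.
Qed.

Lemma mirror_conservative_ge0_integral (f : R -> \bar R) :
  measurable_fun [set: R] f -> (forall q, (0 <= f q)%E) ->
  (forall q, 2^-1 <= q <= 1 -> (f q <= f (1 - q)%R)%E) ->
  (\int[P]_t f (p t) <= \int[P]_t f (1 - p t)%R)%E.
Proof.
move=> mf f0 ff.
have [lam m1E] := le_ocitv_measure_add le_m2_m1.
pose f' q := f (1 - q).
have mf' : measurable_fun [set: R] f'.
  by apply: measurableT_comp => //; exact: measurable_funB.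
have f'0 q : (0 <= f' q)%E by exact: f0.
(* Splits the expectation according to [p >= 1/2] or [p < 1/2]; the second part is expressed through
   [1 - p], so that both integrals live on the upper half. *)
have splitE (h : R -> \bar R) : measurable_fun [set: R] h ->
    (forall q, (0 <= h q)%E) ->
  (\int[P]_t h (p t) =
    \int[m1]_(q in E) h q + \int[m2]_(q in D) h (1 - q)%R)%E.
  move=> mh h0.
  have mXE : measurable (X @^-1` E) by rewrite -[X in measurable X]setTI; exact: mp.
  have mXD : measurable (XN @^-1` D) by rewrite -[X in measurable X]setTI; exact: mpN.
  rewrite (_ : [set: T] = X @^-1` E `|` XN @^-1` D); last first.
    apply/seteqP; split=> t // _; have := p01 t; rewrite /E /D/= !in_itv/=.
    by move=> /andP[t0 t1]; case: (leP 2^-1 (p t)) => ?; [left|right];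
      apply/andP; split; lra.
  rewrite ge0_integral_setU//; last 2 first.
  - by apply: measurable_funTS; apply: measurableT_comp.
  - apply/disj_setPS => t [] /=; rewrite /E /D/= !in_itv/=.
    by move=> /andP[t2 _] /andP[? _]; lra.
  congr (_ + _)%E.
    rewrite -(@ge0_integral_pushforward _ _ _ _ _ _ mp P E h)//; last first.
      exact: measurable_funTS.
    by apply: eq_measure_integral => A mA AE; rewrite /m1/= /mrestr setIidl.
  transitivity (\int[P]_(t in XN @^-1` D) (h \o (fun q => 1 - q)%R \o XN) t)%E.
    by apply: eq_integral => t _; rewrite /= subKr.
  rewrite -(@ge0_integral_pushforward _ _ _ _ _ _ mpN P D (h \o (fun q => 1 - q)))//.
    by apply: eq_measure_integral => A mA AE; rewrite /m2/= /mrestr setIidl.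
    apply: measurable_funTS; apply: measurableT_comp => //.
    exact: measurable_funB.
  by move=> q _; exact: h0.
(* [E] exceeds [D] only by the point 1/2, which is [m2]-null. *)
have m2E (k : R -> \bar R) : measurable_fun [set: R] k ->
    (forall q, (0 <= k q)%E) ->
  (\int[m2]_(q in E) k q = \int[m2]_(q in D) k q)%E.
  move=> mk k0; rewrite /E -(@setU1itv _ _ _ _ false); last first.
    by rewrite bnd_simp/=; lra.
  rewrite ge0_integral_setU//; last 2 first.
  - exact: measurable_funTS.
  - by apply/disj_setPS => _ [->]/=; rewrite in_itv/= ltxx.
  rewrite (eq_measure_integral mzero) ?integral_measure_zero ?add0e//.
  move=> A mA A2; rewrite /m2/= /mrestr (_ : A `&` D = set0) ?measure0//.
  by apply/seteqP; split => q //= -[/A2 ->]; rewrite /D/= in_itv/= ltxx.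
have m1lam (k : R -> \bar R) : measurable_fun [set: R] k ->
    (forall q, (0 <= k q)%E) ->
  (\int[m1]_(q in E) k q = \int[m2]_(q in D) k q + \int[lam]_(q in E) k q)%E.
  move=> mk k0; rewrite -m2E// -ge0_integral_measure_add//.
    by apply: eq_measure_integral => A mA _; exact: m1E.
  exact: measurable_funTS.
rewrite (splitE f)// (splitE f')// !m1lam//.
have -> : (\int[m2]_(q in D) f' (1 - q)%R = \int[m2]_(q in D) f q)%E.
  by apply: eq_integral => q _; rewrite /f' subKr.
(* Both sides contain the [m2]-integrals of [f] and of [f'], in opposite order. Only the
   [lam]-integrals over [E] remain to be compared; nothing is subtracted, so infinite values do no
   harm. *)
rewrite [leLHS]addeAC [leRHS]addeAC [X in (_ <= X + _)%E]addeC leeD2l//.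
apply: ge0_le_integral => //.
- exact: measurable_funTS.
- exact: measurable_funTS.
Qed.

End mirror_integral.

(** * Joint law of an independent pair *)

Section independent_pair.
Context {R : realType} d (T : measurableType d) (P : probability T R).
Context (X Y : {RV P >-> R}) (XY : independent_RV X Y).

(** Independence makes the joint law agree with the product of the laws on rectangles, hence
    everywhere; the product measure is by construction an integral of sections. *)
Lemma independent_RV_probability (B : set (R * R)) : measurable B ->
  P [set t | B (X t, Y t)] =
  (\int[P]_t distribution P Y (xsection B (X t)))%E.
Proof.
move=> mB.
have mXY : measurable_fun [set: T] (fun t => (X t, Y t)).
  exact: measurable_fun_pair.
pose phi : {mfun T >-> (R * R)%type} :=
  HB.pack (fun t => (X t, Y t)) (isMeasurableFun.Build _ _ _ _ _ mXY).
transitivity (distribution P phi B) => //.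
rewrite -(@product_measure_unique _ _ _ _ R (distribution P X) (distribution P Y)
  (distribution P phi) _ B mB); last first.
  by move=> A C mA mC; rewrite -XY.
rewrite /product_measure1/= ge0_integral_pushforward//.
  exact: measurable_fun_xsection.
Qed.

End independent_pair.

(** * Mirror-conservativeness of the noisy p-value *)

Theorem theorem1 (R : realType)
    (nu : {measure set (measurableTypeR R) -> \bar R}) (U : \bar R) (g : R -> R)
    (hg : transformation_density nu U g)
    (d : measure_display) (T : measurableType d) (P : probability T R)
    (p Z : {RV P >-> R}) (sigma : R) (hsigma : 0 < sigma)
    (hp : mirror_conservative P p)
    (hZ : gaussian_RV Z 0 sigma)
    (hpZ : independent_RV p Z) :
  mirror_conservative P (noisy_pvalue nu U g p Z).
Proof.
have [_ p01 _] := hp.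
have sigma0 : sigma != 0 by rewrite gt_eqF.
pose X := cumul_inv nu U g.
pose Psi (w : R * R) := cumul_ext nu g (X w.1 + w.2%:E)%E.
(* [cumul_inv] is only controlled on [0, 1]. *)
pose unit_strip : set (R * R) := `[0, 1]%classic `*` [set: R].
have munit : measurable unit_strip by apply: measurableX.
have mPsi : measurable_fun unit_strip Psi.
  apply: (measurableT_comp (measurable_cumul_ext hg)).
  apply: emeasurable_funD.
    apply: (@measurable_comp _ _ _ _ _ _ (`[0, 1]%classic : set R) X
      unit_strip fst) => //.
    - by move=> _ [w [w1 _] <-].
    - exact: measurable_cumul_inv hg.
    - by apply: measurable_funTS; exact: measurable_fst.
  apply/measurable_EFinP; by apply: measurable_funTS; exact: measurable_snd.
pose B a b := unit_strip `&` Psi @^-1` `[a, b].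
have mB a b : measurable (B a b) by exact: mPsi.
have PE a b : P [set t | a <= noisy_pvalue nu U g p Z t <= b] =
    (\int[P]_t normal_prob 0 sigma (xsection (B a b) (p t)))%E.
  rewrite [LHS](_ : _ = P [set t | B a b (p t, Z t)]).
    rewrite (independent_RV_probability hpZ)//; apply: eq_integral => t _.
    by rewrite hZ//; exact: measurable_xsection.
  congr (P _); apply/seteqP; split=> t /=; rewrite /B /unit_strip/= !in_itv/=.
    by move=> ->; rewrite p01.
  by case.
split.
- rewrite (_ : noisy_pvalue _ _ _ _ _ = Psi \o (fun t => (p t, Z t)))//.
  apply: (measurable_comp munit _ mPsi); last exact: measurable_fun_pair.
  by move=> _ [t _ <-]; split => //=; rewrite in_itv/= p01.
- by move=> t; exact: (cumul_ext_bounds hg).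
move=> a1 a2 a10 a12 a2h.
pose f q := normal_prob 0 sigma (xsection (B a1 a2) q).
(* Mirroring [p] and reflecting the noise together mirror the noisy p-value. The noise is finite, so
   the opposite distributes over the sum even when [X q] is infinite. *)
have PsiN q z : 0 <= q <= 1 -> Psi (1 - q, z) = 1 - Psi (q, - z).
  move=> q01; rewrite /Psi/= /X (cumul_inv_onem hg q01) -(cumul_extN hg).
  by rewrite fin_num_oppeD// EFinN oppeK.
have xsE a b q : 0 <= q <= 1 ->
    xsection (B a b) q = [set z | a <= Psi (q, z) <= b].
  move=> q01; apply/seteqP; split=> z;
    rewrite /xsection/= inE /B/= /unit_strip/= !in_itv/=.
    by case.
  by [].
have -> : P [set t | 1 - a2 <= noisy_pvalue nu U g p Z t <= 1 - a1] =
    (\int[P]_t f (1 - p t)%R)%E.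
  rewrite PE; apply: eq_integral => t _; rewrite /f.
  have q01 := p01 t; have q01' : 0 <= 1 - p t <= 1 by move: q01; lra.
  rewrite -(normal_probN sigma0); last exact: measurable_xsection.
  congr (normal_prob _ _ _); rewrite !xsE//; apply/seteqP; split => z /=.
    by rewrite PsiN//; lra.
  by rewrite PsiN//; lra.
rewrite PE; apply: (mirror_conservative_ge0_integral hp).
- exact: (measurable_fun_xsection (normal_prob 0 sigma) (mB a1 a2)).
- by move=> q; exact: (measure_ge0 (normal_prob 0 sigma)).
move=> q /andP[q2 q1].
have q01 : 0 <= q <= 1 by rewrite q1 andbT (le_trans _ q2)// invr_ge0.
have q01' : 0 <= 1 - q <= 1 by move: q01; lra.
rewrite /f !xsE//.
have : (0 <= X q)%E by rewrite (cumul_inv_ge0 hg)// q2.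
have := cumul_inv_onem hg q01; rewrite -/X.
(* The value -oo contradicts [0 <= X q]. If [X q] is +oo, the noisy p-value is 1, above [a2 <= 1/2],
   whatever the noise. *)
case XqE : (X q) => [x| |]// XqN x0; last first.
  rewrite [X in (normal_prob _ _ X <= _)%E](_ : _ = set0) ?measure0//.
  apply/seteqP; split=> z //=; rewrite /Psi/= XqE/=; lra.
pose A := cumul nu g @^-1` `[a1, a2].
have mA : measurable A.
  rewrite /A -[X in measurable X]setTI.
  exact: (nondecreasing_measurable measurableT (cumul_nondecreasing hg)).
have PsiA s y : X s = y%:E ->
    [set z | a1 <= Psi (s, z) <= a2] = +%R y @^-1` A.
  by move=> Xsy; rewrite /Psi/= Xsy; apply/seteqP; split => z /=;
    rewrite /A/= in_itv.
(* The two events are the translates of [A] by opposite amounts, and [A] lies in ]-oo, 0] because G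
   exceeds 1/2 at positive points. *)
rewrite (PsiA _ _ XqE) (PsiA _ _ XqN).
apply: (normal_prob_le_shift sigma0 mA); first by rewrite -lee_fin.
move=> y; rewrite /A/= in_itv/= => /andP[_ ya2]; rewrite leNgt; apply/negP.
by move=> /(cumul_gt_half hg); lra.
Qed.
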